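(* Let $n\ge1$ and $d_1>0$. For every permutation $\pi\in S_3$ of $\{1,2,4\}$ and every $b\in\Delta_n=\{1,2,4,7\}^n$, $$P(\pi b)=\rho(\pi)P(b),$$ where $\pi b$ denotes the digitwise application of $\pi$ to the word $b$.
   Context: The vectors in $\mathbb R^2$ are $v(1)=(\cos 210^\circ,\sin 210^\circ)$, $v(2)=(\cos 90^\circ,\sin 90^\circ)$, $v(4)=(\cos 330^\circ,\sin 330^\circ)$, $v(7)=(0,0)$. For a fixed scale $d_1>0$ put $d_r=d_1/2^{r-1}$. The centroid map $P:\Delta_n\to\mathbb R^2$ is $P(b)=\sum_{r=1}^n\sigma_r d_r v(b_r)$ for $b=b_1\cdots b_n$, where $\sigma_r=(-1)^{\#\{s<r:\,b_s=7\}}$. The group $S_3$ of permutations of $\{1,2,4\}$ acts on $\Delta_n$ by permuting the digits $1,2,4$ in each position and fixing the digit $7$. For $\pi\in S_3$, $\rho(\pi)$ is the unique linear symmetry of the plane (an element of the dihedral group $D_3$ of the equilateral triangle with vertices $v(1),v(2),v(4)$) such that $\rho(\pi)v(a)=v(\pi(a))$ for $a\in\{1,2,4\}$. *)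

(* Defs.v *)
From HB Require Import structures.
From mathcomp Require Import all_boot all_order all_algebra all_fingroup.
From mathcomp Require Import all_classical all_reals all_analysis.
From mathcomp Require Import ring lra.
Set Implicit Arguments.
Unset Strict Implicit.
Unset Printing Implicit Defensive.
Import Order.TTheory GRing.Theory Num.Theory.
Local Open Scope classical_set_scope.
Local Open Scope ring_scope.

Inductive corner : predArgType := c1 | c2 | c4.

Definition corner_to_ord (a : corner) : 'I_3 :=
  match a with
  | c1 => @Ordinal 3 0 isT
  | c2 => @Ordinal 3 1 isT
  | c4 => @Ordinal 3 2 isT
  end.

Definition corner_of_ord (i : 'I_3) : corner :=
  match val i with 0%N => c1 | 1%N => c2 | _ => c4 end.

Lemma corner_to_ordK : cancel corner_to_ord corner_of_ord.
Proof. by case. Qed.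

HB.instance Definition _ := Finite.copy corner (can_type corner_to_ordK).

(* The digits are [Some c1], [Some c2], [Some c4] for 1, 2, 4,
   and [None] for 7. *)
Definition digit := option corner.
Notation digit7 := (@None corner) (only parsing).

Notation word n := (n.-tuple digit).

Definition act_digit (p : {perm corner}) : digit -> digit := omap p.

Definition act_word (n : nat) (p : {perm corner}) (b : word n) : word n :=
  map_tuple (act_digit p) b.

Section Plane.
Variable R : realType.

Definition deg (x : R) : R := x * pi / 180.

Definition vec2 (x y : R) : 'cV[R]_2 := \col_(i < 2) (if i == 0 then x else y).

Definition polar (t : R) : 'cV[R]_2 := vec2 (cos t) (sin t).

Definition v (a : digit) : 'cV[R]_2 :=
  match a with
  | Some c1 => polar (deg 210)
  | Some c2 => polar (deg 90)
  | Some c4 => polar (deg 330)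
  | None => 0
  end.

(* Positions are numbered from 0, so position [r : 'I_n] here is r + 1 in the
   usual numbering and d1 / 2 ^ (r + 1 - 1) = d1 / 2 ^ r. *)
Definition scale (d1 : R) (r : nat) : R := d1 / 2 ^+ r.

Definition sigma (n : nat) (b : word n) (r : 'I_n) : R :=
  (-1) ^+ #|[set s : 'I_n | (s < r)%N && (tnth b s == digit7)]%SET|.

Definition P (n : nat) (d1 : R) (b : word n) : 'cV[R]_2 :=
  \sum_(r < n) (sigma b r * scale d1 r) *: v (tnth b r).

Definition vertices : set 'cV[R]_2 := range (fun a : corner => v (Some a)).

(* The dihedral group of the triangle, as a set of matrices acting on column
   vectors: linear isometries mapping the set of vertices onto itself. *)
Definition D3 : set 'M[R]_2 :=
  [set M | M^T *m M = 1%:M /\ mulmx M @` vertices = vertices].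

Definition induces (p : {perm corner}) (M : 'M[R]_2) : Prop :=
  D3 M /\ forall a : corner, M *m v (Some a) = v (Some (p a)).

(* The unique matrix in [induces p]; the default value 0 is never used,
   see [rho_exists_unique] and [rhoP]. *)
Definition rho (p : {perm corner}) : 'M[R]_2 := xget 0 (induces p).

Let k : R := cos (pi / 6).

Lemma cos_pi3 : cos (pi / 3) = 2^-1 :> R.
Proof.
set c : R := cos _.
have pi0 := @pi_gt0 R.
have c0 : 0 < c by apply: cos_gt0_pihalf; apply/andP; split; lra.
have : cos (pi / 3 *+ 2 + pi / 3) = -1 :> R.
  by rewrite -cospi; congr cos; rewrite mulr2n; field.
rewrite cosD cos_mulr2n sin_mulr2n -/c => e.
have s2 := cos2Dsin2 (pi / 3 : R); rewrite -/c in s2.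
have sE : sin (pi / 3) ^+ 2 = 1 - c ^+ 2 by lra.
have h : (c ^+ 2 *+ 2 - 1) * c - 2 * c * (1 - c ^+ 2) = -1.
  by rewrite -sE -[RHS]e; ring.
have : (c + 1) * (2 * c - 1) ^+ 2 = 0.
  transitivity ((c ^+ 2 *+ 2 - 1) * c - 2 * c * (1 - c ^+ 2) + 1); first by ring.
  by rewrite h addNr.
move/eqP; rewrite mulf_eq0 expf_eq0 /= => /orP[/eqP|/eqP]; lra.
Qed.

Lemma sin_pi6 : sin (pi / 6) = 2^-1 :> R.
Proof. by rewrite -cos_pi3 -cosBpihalf -cosN; congr cos; field. Qed.

Lemma k2 : k ^+ 2 = 3 / 4.
Proof.
have := cos2Dsin2 (pi / 6 : R).
by rewrite sin_pi6 -/k => h; rewrite -[LHS](addrK (2^-1 ^+ 2)) h; field.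
Qed.

Lemma v1E : v (Some c1) = vec2 (- k) (- 2^-1).
Proof.
rewrite /v /polar (_ : deg 210 = pi / 6 + pi); last by rewrite /deg; field.
by rewrite cosDpi sinDpi sin_pi6.
Qed.

Lemma v2E : v (Some c2) = vec2 0 1.
Proof.
rewrite /v /polar (_ : deg 90 = pi / 2); last by rewrite /deg; field.
by rewrite cos_pihalf sin_pihalf.
Qed.

Lemma v4E : v (Some c4) = vec2 k (- 2^-1).
Proof.
rewrite /v /polar (_ : deg 330 = - (pi / 6) + pi *+ 2); last first.
  by rewrite /deg mulr2n; field.
by rewrite cosD2pi sinD2pi cosN sinN sin_pi6.
Qed.

Lemma mul_vec2T (x y x' y' : R) :
  (vec2 x y)^T *m vec2 x' y' = (x * x' + y * y')%:M.
Proof.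
by apply/matrixP => i j; rewrite !mxE big_ord_recl big_ord1 !mxE !ord1 /= mulr1n.
Qed.

Lemma gram (a b : corner) :
  (v (Some a))^T *m v (Some b) = (if a == b then 1 else - 2^-1)%:M.
Proof.
have kk : k * k = 3 / 4 by rewrite -expr2 k2.
case: a; case: b; rewrite ?v1E ?v2E ?v4E mul_vec2T; congr (_%:M);
  rewrite ?eqxx ?[if _ == _ then _ else _]ifF // ?(mulrNN k) ?mulrN ?mulNr ?kk //;
  try (by field); by apply/eqP.
Qed.

Lemma vec2_span (x : 'cV[R]_2) :
  x = (x 1 0 + x 0 0 / (2 * k)) *: v (Some c2)
      + (x 0 0 / k) *: v (Some c4).
Proof.
have k0 : k != 0.
  by apply/eqP => k0; have := k2; rewrite k0; lra.
rewrite v2E v4E; apply/matrixP => i j; rewrite !mxE !ord1.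
case: i => [[|[|//]]] i //=.
  rewrite (_ : Ordinal i = 0); last exact/val_inj.
  by field.
by rewrite (_ : Ordinal i = 1); [field | exact/val_inj].
Qed.

Lemma mulmx_v_inj (m : nat) (M N : 'M[R]_(m, 2)) :
  (forall a : corner, M *m v (Some a) = N *m v (Some a)) -> M = N.
Proof.
move=> h.
have h' (x : 'cV[R]_2) : M *m x = N *m x.
  by rewrite (vec2_span x) !mulmxDr -!scalemxAr !h.
apply/matrixP => i j; have := h' (delta_mx j 0).
by rewrite -!colE => /matrixP/(_ i 0); rewrite !mxE.
Qed.

Lemma v_dual_inj (x y : 'cV[R]_2) :
  (forall a : corner, (v (Some a))^T *m x = (v (Some a))^T *m y) -> x = y.
Proof.
move=> h; apply: trmx_inj; apply: mulmx_v_inj => a.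
by apply: trmx_inj; rewrite !trmx_mul !trmxK h.
Qed.

Lemma sum_v : \sum_(a : corner) v (Some a) = 0.
Proof.
have : (\sum_(a : corner) v (Some a)) = v (Some c1) + v (Some c2) + v (Some c4).
  rewrite (bigD1 c1) // (bigD1 c2) //.
  rewrite (bigD1 c4) //= big1 ?addr0 ?addrA //.
  by case.
move=> ->; rewrite v1E v2E v4E; apply/matrixP => i j; rewrite !mxE.
by case: ifP => _; field.
Qed.

Lemma rho_exists_unique (p : {perm corner}) :
  exists! M : 'M[R]_2, induces p M.
Proof.
pose M : 'M[R]_2 := (2 / 3) *: \sum_a v (Some (p a)) *m (v (Some a))^T.
have ME c : M *m v (Some c) = v (Some (p c)).
  rewrite /M -scalemxAl mulmx_suml.
  under eq_bigr => a _ do rewrite -mulmxA gram mul_mx_scalar.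
  have sp : \sum_a v (Some (p a)) = 0.
    by rewrite -[RHS]sum_v [RHS](reindex_inj (@perm_inj _ p)).
  rewrite (bigD1 c) //= eqxx.
  rewrite (eq_bigr (fun a => (- 2^-1) *: v (Some (p a)))); last first.
    by move=> a /negbTE ->.
  rewrite -scaler_sumr.
  move: sp; rewrite (bigD1 c) //= => /eqP; rewrite addrC addr_eq0 => /eqP ->.
  rewrite scalerN scaleNr opprK -scalerDl scalerA.
  by rewrite (_ : 2 / 3 * (1 + 2^-1) = 1 :> R) ?scale1r //; field.
exists M; split; last first.
  by move=> N [_ NE]; apply: mulmx_v_inj => a; rewrite ME NE.
split=> //; split.
  apply: mulmx_v_inj => b; rewrite mul1mx.
  apply: (@v_dual_inj) => a.
  rewrite -mulmxA ME mulmxA -trmx_mul ME !gram.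
  by rewrite (inj_eq (@perm_inj _ p)).
apply/seteqP; split => [x [_ [a _ <-] <-]|x [a _ <-]].
  by rewrite ME; exists (p a).
exists (v (Some ((p^-1)%g a))); first by exists ((p^-1)%g a).
by rewrite ME permKV.
Qed.

Lemma rhoP (p : {perm corner}) : induces p (rho p).
Proof. by have [M [HM _]] := rho_exists_unique p; apply: xgetI HM. Qed.

End Plane.

(* Main.v *)
Require Import Defs.
From HB Require Import structures.
From mathcomp Require Import all_boot all_order all_algebra all_fingroup.
From mathcomp Require Import all_classical all_reals all_analysis.
Set Implicit Arguments.
Unset Strict Implicit.
Unset Printing Implicit Defensive.
Import Order.TTheory GRing.Theory Num.Theory.
Local Open Scope ring_scope.

(** Permuting the corners leaves the positions of the digit 7 in place, so the signs do not change
    ([sigma_act_word]), and the scales depend on position only. Each vector is moved by the one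
    matrix [rho R p] ([v_act_digit]), which factors out of the sum by linearity. *)

Lemma sigma_act_word (R : realType) (n : nat) (p : {perm corner}) (b : word n)
    (r : 'I_n) : sigma R (act_word p b) r = sigma R b r.
Proof.
rewrite /sigma; congr (_ ^+ _); apply: eq_card => s.
(* [omap] sends [None] to [None] and corners to corners, so the test for 7 computes to the same
   boolean. *)
by rewrite !inE tnth_map; case: (tnth b s).
Qed.

(** For corners this is the defining property of [rho]; the digit 7 sits at the origin, which every
    linear map fixes. *)
Lemma v_act_digit (R : realType) (p : {perm corner}) (a : digit) :
  v R (act_digit p a) = rho R p *m v R a.
Proof.
case: a => [a|]; last by rewrite /= mulmx0.
by have [_ ->] := rhoP R p.
Qed.

Theorem theorem4p3 (R : realType) (n : nat) (d1 : R)
    (hn : (1 <= n)%N) (hd1 : 0 < d1) (p : {perm corner}) (b : word n) :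
  P d1 (act_word p b) = rho R p *m P d1 b.
Proof.
rewrite /P mulmx_sumr; apply: eq_bigr => r _.
by rewrite sigma_act_word tnth_map v_act_digit scalemxAr.
Qed.
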